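(* There are absolute constants $C_1,C_2>0$ (independent of $d,\mathbf{B},f,L,m,\mathbf{x}_0,\varepsilon,k$) such that the following holds. Let $m\ge1$ be an integer, $M:=3mL$, $\varepsilon>0$, let $\nabla f(\mathbf{x}_0)\ne 0$, and let $\mathbf{x}_0,\mathbf{x}_1,\dots$ be generated by the Regularized Newton method with Lazy Hessians (with parameters $m$ and $M$). Assume that the gradients for the previous iterations $\{\mathbf{x}_i\}_{i=1}^k$ satisfy $\|\nabla f(\mathbf{x}_i)\|_*\ge\varepsilon$ for all $1\le i\le k$. Then the number $k$ of iterations to reach accuracy $\|\nabla f(\mathbf{x}_{k+1})\|_*\le\varepsilon$ is at most $$k\;\le\;C_1\frac{\sqrt{mL}\,(f(\mathbf{x}_0)-f^\star)}{\varepsilon^{3/2}}+C_2\ln\frac{\|\nabla f(\mathbf{x}_0)\|_*}{\varepsilon},$$ and the total number $t$ of Hessian updates during these iterations is bounded as $$t\;\le\;C_1\frac{\sqrt{L}\,(f(\mathbf{x}_0)-f^\star)}{\varepsilon^{3/2}\sqrt m}+\frac{C_2}{m}\ln\frac{\|\nabla f(\mathbf{x}_0)\|_*}{\varepsilon}.$$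
   Context: $\mathbf{B}\in\mathbb{R}^{d\times d}$ is a fixed symmetric positive definite matrix, $\|\mathbf{x}\|=\langle \mathbf{B}\mathbf{x},\mathbf{x}\rangle^{1/2}$, $\|\mathbf{g}\|_*=\langle \mathbf{g},\mathbf{B}^{-1}\mathbf{g}\rangle^{1/2}$ for gradients, and $\|\mathbf{A}\|=\sup_{\|\mathbf{x}\|\le1}\|\mathbf{A}\mathbf{x}\|_*$ for matrices. The function $f:\mathbb{R}^d\to\mathbb{R}$ is convex, twice continuously differentiable, bounded below with $\inf f\ge f^\star\in\mathbb{R}$, and $\|\nabla^2 f(\mathbf{x})-\nabla^2 f(\mathbf{y})\|\le L\|\mathbf{x}-\mathbf{y}\|$ for all $\mathbf{x},\mathbf{y}\in\mathbb{R}^d$, with $L>0$. Regularized Newton with Lazy Hessians: given $\mathbf{x}_0\in\mathbb{R}^d$, for $k=0,1,\dots$ (as long as $\nabla f(\mathbf{x}_k)\neq0$) set the last snapshot point $\mathbf{z}_k=\mathbf{x}_{\pi(k)}$, the regularization parameter $\lambda_k=\sqrt{M\|\nabla f(\mathbf{x}_k)\|_*}$, and compute $$\mathbf{x}_{k+1}=\mathbf{x}_k-\bigl(\nabla^2 f(\mathbf{z}_k)+\lambda_k\mathbf{B}\bigr)^{-1}\nabla f(\mathbf{x}_k),$$ where $\pi(k)=k-(k\bmod m)$ is the largest multiple of $m$ not exceeding $k$. A Hessian update is a computation of the Hessian $\nabla^2 f$ at a new snapshot point; it is made once per $m$ iterations, at the iterations whose index $k$ is a multiple of $m$, and the Hessian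 is reused in between.
   Formalization: Proved for k≥1, or k=0 with ‖∇f(x_0)‖_*≥ε (else the logarithm can make the bound negative); the bound on t counts the initial Hessian at x_0 only when k≥m, otherwise only updates at iterations 1..k, since for k<m the stated bound can be below 1. *)

(* Defs.v *)
From HB Require Import structures.
From mathcomp Require Import all_boot all_order all_algebra.
From mathcomp Require Import all_classical all_reals all_analysis.

Set Implicit Arguments.
Unset Strict Implicit.
Unset Printing Implicit Defensive.

Import Order.TTheory GRing.Theory Num.Theory.
Import numFieldNormedType.Exports.

Local Open Scope classical_set_scope.
Local Open Scope ring_scope.

(* Points and gradients are column vectors; <u, v> = u^T v. *)
Definition dotv (R : realType) (d : nat) (u v : 'cV[R]_d) : R :=
  (u^T *m v) 0 0.

Definition sym_posdef (R : realType) (d : nat) (B : 'M[R]_d) : Prop :=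
  B^T = B /\ forall x : 'cV[R]_d, x != 0 -> 0 < dotv (B *m x) x.

Definition pnorm (R : realType) (d : nat) (B : 'M[R]_d) (x : 'cV[R]_d) : R :=
  Num.sqrt (dotv (B *m x) x).

Definition dnorm (R : realType) (d : nat) (B : 'M[R]_d) (g : 'cV[R]_d) : R :=
  Num.sqrt (dotv g (invmx B *m g)).

(* For B symmetric positive definite the set below is nonempty and bounded, so
   [sup] is the true supremum. *)
Definition opnorm (R : realType) (d : nat) (B A : 'M[R]_d) : R :=
  sup [set dnorm B (A *m x) | x in [set x : 'cV[R]_d | pnorm B x <= 1]].

Definition gradient (R : realType) (d : nat) (f : 'cV[R]_d -> R)
    (x : 'cV[R]_d) : 'cV[R]_d :=
  \col_i 'D_(delta_mx i 0) f x.

Definition hessian (R : realType) (d : nat) (f : 'cV[R]_d -> R)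
    (x : 'cV[R]_d) : 'M[R]_d :=
  \matrix_(i, j) 'D_(delta_mx j 0) (fun y => gradient f y i 0) x.

(* The derivatives in [gradient] and [hessian] are total functions; they are
   the genuine partial derivatives under this predicate. *)
Definition twice_continuously_differentiable (R : realType) (d : nat)
    (f : 'cV[R]_d -> R) : Prop :=
  [/\ forall x, differentiable f x,
      forall x, differentiable (gradient f) x
    & continuous (hessian f)].

Definition snapshot (m k : nat) : nat := (k - k %% m)%N.

(* The equation is imposed only while the gradient is nonzero: once the method
   has stopped, the remaining terms of [x] are unconstrained. *)
Definition lazy_newton (R : realType) (d : nat) (B : 'M[R]_d)
    (f : 'cV[R]_d -> R) (m : nat) (M : R) (x : nat -> 'cV[R]_d) : Prop :=
  forall k : nat, gradient f (x k) != 0 ->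
    let z := x (snapshot m k) in
    let lambda := Num.sqrt (M * dnorm B (gradient f (x k))) in
    x k.+1 = x k - invmx (hessian f z + lambda *: B) *m gradient f (x k).

(* Number of Hessian updates at the iterations with index a <= i <= b. *)
Definition hessian_updates (m a b : nat) : nat :=
  count (fun i => m %| i)%N (index_iota a b.+1).

(* Main.v *)
(* Put g_k = |grad f(x_k)|_*, r_k = |x_{k+1} - x_k|, and let D_k be the sum of
   the r_j from the last snapshot up to and including j = k.

   One step: a mean value argument gives
   |grad f(x_{k+1}) + lambda_k B (x_{k+1} - x_k)|_* <= L D_k r_k.  Squaring this
   and using convexity,
     f(x_k) - f(x_{k+1})
       >= g_{k+1}^2 / (2 lambda_k) + lambda_k r_k^2 / 2
          - (L D_k r_k)^2 / (2 lambda_k),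
   where M r_k <= lambda_k because the Hessian is positive semidefinite.

   Summation: inside a block of at most m steps, the sum of r_k D_k^2 is at most
   (sum r_k)^3 <= m^2 (sum r_k^3), so with M = 3 m L the error terms are absorbed
   and the sum of g_{k+1}^2 / (2 lambda_k) is at most f(x_0) - fstar.  As
   lambda_k = sqrt (M g_k), each summand is at least a constant times
   eps^(3/2) / sqrt M * sqrt (g_{k+1} / g_k), and sqrt t >= 1 + ln t / 2 makes the
   logarithms telescope. *)

Require Import Defs.
From HB Require Import structures.
From mathcomp Require Import all_boot all_order all_algebra.
From mathcomp Require Import all_classical all_reals all_analysis.
From mathcomp Require Import ring lra.

Set Implicit Arguments.
Unset Strict Implicit.
Unset Printing Implicit Defensive.

Import Order.TTheory GRing.Theory Num.Theory.
Import numFieldNormedType.Exports.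

Local Open Scope classical_set_scope.
Local Open Scope ring_scope.

(** * Dot products, and invertibility from a positive quadratic form *)

Section DotProduct.
Variables (R : realType) (d : nat).
Implicit Types (u v w : 'cV[R]_d) (A B : 'M[R]_d).

Lemma dotvE u v : dotv u v = \sum_i u i 0 * v i 0.
Proof. by rewrite /dotv mxE; apply: eq_bigr => i _; rewrite mxE. Qed.

Lemma dotvC u v : dotv u v = dotv v u.
Proof. by rewrite !dotvE; apply: eq_bigr => i _; rewrite mulrC. Qed.

Lemma dotvDl u v w : dotv (u + v) w = dotv u w + dotv v w.
Proof. by rewrite /dotv linearD mulmxDl mxE. Qed.

Lemma dotvZl a u w : dotv (a *: u) w = a * dotv u w.
Proof. by rewrite /dotv linearZ -scalemxAl mxE. Qed.

Lemma dotvNl u w : dotv (- u) w = - dotv u w.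
Proof. by rewrite -scaleN1r dotvZl mulN1r. Qed.

Lemma dotvDr u v w : dotv w (u + v) = dotv w u + dotv w v.
Proof. by rewrite dotvC dotvDl !(dotvC w). Qed.

Lemma dotvZr a u w : dotv w (a *: u) = a * dotv w u.
Proof. by rewrite dotvC dotvZl (dotvC w). Qed.

Lemma dotvNr u w : dotv w (- u) = - dotv w u.
Proof. by rewrite dotvC dotvNl (dotvC w). Qed.

Lemma dotv0l w : dotv 0 w = 0.
Proof. by rewrite -(scale0r w) dotvZl mul0r. Qed.

Lemma dotv_mull A u v : dotv (A *m u) v = dotv u (A^T *m v).
Proof. by rewrite /dotv trmx_mul mulmxA. Qed.

(** A vector killed by [A] makes the quadratic form vanish, hence is zero. This serves both for [B]
    and for the regularized Hessian. *)
Lemma coercive_unitmx A : (forall x : 'cV[R]_d, x != 0 -> 0 < dotv (A *m x) x) ->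
  A \in unitmx.
Proof.
move=> A0; rewrite -unitmx_tr -row_free_unit -kermx_eq0; apply/rowV0P => v /sub_kermxP vA.
apply/eqP; rewrite -[_ == _]negbK; apply/negP => v0.
have := A0 v^T; rewrite -(inj_eq trmx_inj) trmxK trmx0 => /(_ v0).
by rewrite -[A]trmxK -trmx_mul vA trmx0 dotv0l ltxx.
Qed.

End DotProduct.

(** * The norm of [B], its dual norm and the operator norm *)

Section EnergyNorms.
Variables (R : realType) (d : nat) (B : 'M[R]_d).
Hypothesis HB : sym_posdef B.
Implicit Types (u v w x g : 'cV[R]_d) (A : 'M[R]_d).

Lemma posdef_unitmx : B \in unitmx.
Proof. by case: HB => _; exact: coercive_unitmx. Qed.

Lemma pform_ge0 u : 0 <= dotv (B *m u) u.
Proof.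
by have [->|/(proj2 HB)/ltW//] := eqVneq u 0; rewrite mulmx0 dotv0l.
Qed.

Lemma pformC u v : dotv (B *m u) v = dotv (B *m v) u.
Proof. by rewrite dotv_mull (proj1 HB) dotvC. Qed.

(** Cauchy-Schwarz: in the notation of the proof, the form at [a *: u - b *: v] is nonnegative and
    equals [a * (c * a - b ^+ 2)], where [a > 0]. *)
Lemma pform_cauchy u v : dotv (B *m u) v ^+ 2 <= dotv (B *m u) u * dotv (B *m v) v.
Proof.
have [->|v0] := eqVneq v 0; first by rewrite mulmx0 dotv0l pformC mulmx0 dotv0l expr0n mulr0.
have a0 := proj2 HB v v0; set a := dotv (B *m v) v in a0 *.
set b := dotv (B *m u) v; have := pform_ge0 (a *: u - b *: v).
rewrite mulmxDr mulmxN -!scalemxAr !(dotvDl, dotvNl, dotvDr, dotvNr, dotvZl, dotvZr).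
rewrite (pformC v u) -/a -/b.
set c := dotv (B *m u) u => H.
rewrite -subr_ge0 -(pmulr_rge0 _ a0); apply: le_trans H _.
by rewrite le_eqVlt; apply/orP; left; apply/eqP; ring.
Qed.

Lemma pnorm_ge0 u : 0 <= pnorm B u. Proof. exact: sqrtr_ge0. Qed.

Lemma sqr_pnorm u : pnorm B u ^+ 2 = dotv (B *m u) u.
Proof. by rewrite sqr_sqrtr ?pform_ge0. Qed.

Lemma pform_le u v : `|dotv (B *m u) v| <= pnorm B u * pnorm B v.
Proof.
rewrite -(@ler_pXn2r _ 2) ?nnegrE ?mulr_ge0 ?pnorm_ge0 //.
by rewrite exprMn !sqr_pnorm real_normK ?num_real // pform_cauchy.
Qed.

Lemma pnormD u v : pnorm B (u + v) <= pnorm B u + pnorm B v.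
Proof.
rewrite -(@ler_pXn2r _ 2) ?nnegrE ?addr_ge0 ?pnorm_ge0 //.
rewrite sqrrD !sqr_pnorm mulmxDr !(dotvDl, dotvDr) (pformC v u).
have := le_trans (ler_norm _) (pform_le u v); lra.
Qed.

Lemma pnormZ a u : pnorm B (a *: u) = `|a| * pnorm B u.
Proof.
rewrite /pnorm -scalemxAr dotvZl dotvZr mulrA -expr2.
by rewrite sqrtrM ?sqr_ge0 // sqrtr_sqr.
Qed.

Lemma pnorm0 : pnorm B 0 = 0.
Proof. by rewrite /pnorm mulmx0 dotv0l sqrtr0. Qed.

Lemma pnorm_eq0 u : (pnorm B u == 0) = (u == 0).
Proof.
apply/idP/eqP => [|->]; last by rewrite pnorm0.
apply: contraTeq => /(proj2 HB) u0.
by rewrite /pnorm sqrtr_eq0 -ltNge.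
Qed.

Lemma pnorm_sum (I : Type) (r : seq I) (P : pred I) (F : I -> 'cV[R]_d) :
  pnorm B (\sum_(i <- r | P i) F i) <= \sum_(i <- r | P i) pnorm B (F i).
Proof.
elim/big_rec2: _ => [|i y z _ h]; first by rewrite pnorm0.
by apply: le_trans (pnormD _ _) _; rewrite lerD2l.
Qed.

(** Lets the dual norm inherit the properties of [pnorm]. *)
Lemma dnormE g : dnorm B g = pnorm B (invmx B *m g).
Proof. by rewrite /dnorm /pnorm mulKVmx ?posdef_unitmx. Qed.

Lemma dnorm_ge0 g : 0 <= dnorm B g. Proof. exact: sqrtr_ge0. Qed.

Lemma dnorm_gt0 g : g != 0 -> 0 < dnorm B g.
Proof.
move=> g0; rewrite lt_def dnorm_ge0 andbT dnormE pnorm_eq0.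
apply: contra g0 => /eqP h.
by rewrite -(mulKVmx posdef_unitmx g) h mulmx0.
Qed.

Lemma dnorm0 : dnorm B 0 = 0.
Proof. by rewrite dnormE mulmx0 pnorm0. Qed.

Lemma sqr_dnorm g : dnorm B g ^+ 2 = dotv g (invmx B *m g).
Proof. by rewrite dnormE sqr_pnorm mulKVmx ?posdef_unitmx. Qed.

Lemma dotv_le_norm g u : `|dotv g u| <= dnorm B g * pnorm B u.
Proof. by rewrite dnormE -{1}(mulKVmx posdef_unitmx g) pform_le. Qed.

Lemma coord_le_pnorm u i : `|u i 0| <= dnorm B (delta_mx i 0) * pnorm B u.
Proof.
apply: le_trans (dotv_le_norm _ _); rewrite dotvE (bigD1 i) //= big1 => [|j ji].
  by rewrite mxE !eqxx mul1r addr0.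
by rewrite mxE (negPf ji) mul0r.
Qed.

Lemma mulmx_col_sum A u : A *m u = \sum_j u j 0 *: (A *m delta_mx j 0).
Proof.
rewrite {1}(matrix_sum_delta u) mulmx_sumr; apply: eq_bigr => j _.
by rewrite big_ord1 -scalemxAr.
Qed.

(* The supremum defining [opnorm] is only meaningful once its set is known to
   be bounded; coordinates are controlled by the norm, hence so is [A *m u]. *)
Lemma opnorm_has_ubound A :
  has_ubound [set dnorm B (A *m u) | u in [set u : 'cV[R]_d | pnorm B u <= 1]].
Proof.
exists (\sum_j dnorm B (delta_mx j 0) * dnorm B (A *m delta_mx j 0)).
move=> _ [u /= u1 <-]; rewrite dnormE mulmx_col_sum mulmx_sumr.
apply: le_trans (pnorm_sum _ _ _) _; apply: ler_sum => j _.
rewrite -scalemxAr pnormZ -dnormE; apply: ler_wpM2r; first exact: dnorm_ge0.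
apply: le_trans (coord_le_pnorm _ _) _.
by rewrite -[leRHS]mulr1; apply: ler_wpM2l u1; exact: dnorm_ge0.
Qed.

(** Scaling [u] to norm one puts it in the set whose supremum is [opnorm]. *)
Lemma dnorm_mul_le A u : dnorm B (A *m u) <= opnorm B A * pnorm B u.
Proof.
have [->|u0] := eqVneq u 0; first by rewrite mulmx0 dnorm0 pnorm0 mulr0.
have n0 : 0 < pnorm B u by rewrite lt_def pnorm_eq0 u0 pnorm_ge0.
rewrite -ler_pdivrMr //.
have <- : dnorm B (A *m ((pnorm B u)^-1 *: u)) = dnorm B (A *m u) / pnorm B u.
  by rewrite !dnormE -!scalemxAr pnormZ ger0_norm ?invr_ge0 ?ltW // mulrC.
apply: ub_le_sup (opnorm_has_ubound A) _ _.
exists ((pnorm B u)^-1 *: u) => //=.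
by rewrite pnormZ ger0_norm ?invr_ge0 ?(ltW n0) // mulVf ?gt_eqF.
Qed.

End EnergyNorms.

(** * Directional derivatives, the mean value theorem and convexity *)

Section Calculus.
Variables (R : realType) (d : nat).
Implicit Types (f F : 'cV[R]_d -> R) (x y h s u : 'cV[R]_d).

Lemma derive_partialE F x h : differentiable F x ->
  'D_h F x = \sum_i h i 0 * 'D_(delta_mx i 0) F x.
Proof.
move=> dF; rewrite deriveE // {1}(matrix_sum_delta h) linear_sum.
by apply: eq_bigr => i _; rewrite big_ord1 linearZ /= deriveE.
Qed.

Lemma derive_gradientE f x h : differentiable f x ->
  'D_h f x = dotv (gradient f x) h.
Proof.
move=> df; rewrite derive_partialE // dotvE.
by apply: eq_bigr => i _; rewrite mxE mulrC.
Qed.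

Lemma differentiable_dot_gradient f u y : differentiable (gradient f) y ->
  differentiable (fun z => dotv (gradient f z) u) y.
Proof.
move=> dg.
have -> : (fun z => dotv (gradient f z) u) =
    \sum_(i < d) (fun z => gradient f z i 0 * u i 0).
  by apply/funext => z; rewrite dotvE fct_sumE.
apply: differentiable_sum => i; apply: differentiableM => //.
exact: (differentiable_comp dg (differentiable_coord _ _ _)).
Qed.

Lemma derive_dot_gradientE f u s y : differentiable (gradient f) y ->
  'D_s (fun z => dotv (gradient f z) u) y = dotv (hessian f y *m s) u.
Proof.
move=> dg.
have dgi i : differentiable (fun z => gradient f z i 0) y.
  exact: (differentiable_comp dg (differentiable_coord _ _ _)).
have -> : (fun z => dotv (gradient f z) u) =
    \sum_(i < d) (u i 0 *: (fun z => gradient f z i 0)).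
  by apply/funext => z; rewrite dotvE fct_sumE; apply: eq_bigr => i _; rewrite mulrC.
rewrite derive_sum => [|i]; last by apply: derivableZ; exact: diff_derivable.
rewrite dotvE; apply: eq_bigr => i _.
rewrite deriveZ; last exact: diff_derivable.
rewrite mulrC; congr (_ * _); rewrite derive_partialE // mxE.
by apply: eq_bigr => j _; rewrite mxE mulrC.
Qed.

(** The difference quotients of the restriction to the line and of [F] in direction [s] are the same
    function, so existence and value of the limit both transfer. *)
Lemma is_derive_line F x s (t : R) : differentiable F (x + t *: s) ->
  is_derive t 1 (fun r : R => F (x + r *: s)) ('D_s F (x + t *: s)).
Proof.
move=> dF.
pose G (r : R) := F (x + r *: s).
have eqq : (fun r : R => r^-1 *: ((G \o shift t) (r *: 1) - G t)) =
    (fun r : R => r^-1 *: ((F \o shift (x + t *: s)) (r *: s) - F (x + t *: s))).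
  apply/funext => r /=; congr (_ *: (F _ - _)).
  by rewrite [_ *: 1]mulr1 scalerDl addrCA.
apply: DeriveDef.
  by rewrite /derivable eqq; exact: diff_derivable.
by rewrite /derive eqq.
Qed.

(** The mean value theorem is scalar, so the gradient is tested against a fixed [u]; the
    intermediate [t] depends on [u]. *)
Lemma gradient_mvt f x s u : (forall z, differentiable (gradient f) z) ->
  exists2 t : R, 0 <= t <= 1 &
    dotv (gradient f (x + s)) u - dotv (gradient f x) u =
    dotv (hessian f (x + t *: s) *m s) u.
Proof.
move=> dg.
pose phi (t : R) := dotv (gradient f (x + t *: s)) u.
have dphi (t : R) : is_derive t 1 phi (dotv (hessian f (x + t *: s) *m s) u).
  have := is_derive_line (differentiable_dot_gradient u (dg (x + t *: s))).
  by rewrite derive_dot_gradientE.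
have [|t t01] := @MVT_segment R phi _ 0 1 ler01 (fun t _ => dphi t).
  apply: continuous_subspaceT => t.
  by apply: differentiable_continuous; apply/derivable1_diffP; case: (dphi t).
rewrite /phi scale1r scale0r addr0 subr0 mulr1 => ->.
by exists t => //; move: t01; rewrite in_itv.
Qed.

(** By convexity the difference quotient with step [t] in (0, 1] is at most [f (x + h) - f x]; let
    [t] tend to 0 from the right. *)
Lemma convex_gradient_le f x h : convex_function [set: 'cV[R]_d] f ->
  differentiable f x -> dotv (gradient f x) h <= f (x + h) - f x.
Proof.
move=> cf df; rewrite -derive_gradientE //.
have dv : derivable f x h by exact: diff_derivable.
have /cvg_dnbhs_at_right dcv := dv.
rewrite /derive -(cvg_lim (@Rhausdorff R) dcv).
apply: limr_le; first exact: cvgP dcv.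
near=> t.
have t0 : 0 < t by near: t; exact: nbhs_right_gt.
have t1 : t <= 1 by near: t; apply: nbhs_right_le; exact: ltr01.
rewrite /= [_ *: (_ - _)]mulrC ler_pdivrMr //.
have := cf (Itv01 (ltW t0) t1) (x + h) x (mem_set I) (mem_set I).
have -> : conv (Itv01 (ltW t0) t1) (x + h : convex_lmodType _) x = t *: h + x.
  by rewrite /conv /= /unstable.onem scalerBl scale1r scalerDr addrC addrA subrK addrC.
rewrite convRE /= /unstable.onem => ?; lra.
Unshelve. all: by end_near. Qed.

(** Adding the first-order inequalities at [x] and at [x + t *: h] shows that the gradient is
    monotone, so the difference quotients of its component along [h] are nonnegative. *)
Lemma convex_hessian_ge0 f x h : convex_function [set: 'cV[R]_d] f ->
  (forall z, differentiable f z) -> differentiable (gradient f) x ->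
  0 <= dotv (hessian f x *m h) h.
Proof.
move=> cf df dg; rewrite -derive_dot_gradientE //.
have dv : derivable (fun z => dotv (gradient f z) h) x h.
  by apply: diff_derivable; exact: differentiable_dot_gradient.
have /cvg_dnbhs_at_right dcv := dv.
rewrite /derive -(cvg_lim (@Rhausdorff R) dcv).
apply: limr_ge; first exact: cvgP dcv.
near=> t.
have t0 : 0 < t by near: t; exact: nbhs_right_gt.
rewrite /= [_ *: (_ - _)]mulrC pmulr_lge0 ?invr_gt0 //.
have h1 := convex_gradient_le (t *: h) cf (df x).
have h2 := convex_gradient_le (- (t *: h)) cf (df (x + t *: h)).
rewrite addrK in h2; rewrite dotvNr !dotvZr in h1 h2 *.
rewrite -(pmulr_rge0 _ t0) [t *: h + x]addrC; lra.
Unshelve. all: by end_near. Qed.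

End Calculus.

(** * One regularized Newton step from [x], with the Hessian taken at [z] *)

Section Step.
Variables (R : realType) (d : nat) (B : 'M[R]_d) (f : 'cV[R]_d -> R) (L : R).
Hypotheses (HB : sym_posdef B) (fconv : convex_function [set: 'cV[R]_d] f).
Hypothesis fC2 : twice_continuously_differentiable f.
Hypothesis fLip :
  forall y z, opnorm B (hessian f y - hessian f z) <= L * pnorm B (y - z).
Hypothesis L0 : 0 < L.
Implicit Types x z s : 'cV[R]_d.

Lemma hessian_ge0 z h : 0 <= dotv (hessian f z *m h) h.
Proof. by case: fC2 => df dg _; apply: convex_hessian_ge0. Qed.

Lemma regularized_hessian_unitmx z (lam : R) : 0 < lam ->
  hessian f z + lam *: B \in unitmx.
Proof.
move=> lam0; apply: coercive_unitmx => h h0.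
rewrite mulmxDl -scalemxAl dotvDl dotvZl.
by rewrite ltr_wpDl ?hessian_ge0 // mulr_gt0 //; case: HB => _; apply.
Qed.

(** Pair the Newton equation with [s], drop the nonnegative Hessian term, and divide by the norm of
    [s]. *)
Lemma newton_step_le x z s (lam : R) : 0 < lam ->
  (hessian f z + lam *: B) *m s = - gradient f x ->
  lam * pnorm B s <= dnorm B (gradient f x).
Proof.
move=> lam0 eqs.
have [->|s0] := eqVneq s 0; first by rewrite pnorm0 mulr0 dnorm_ge0.
have n0 : 0 < pnorm B s by rewrite lt_def pnorm_eq0 // s0 pnorm_ge0.
rewrite -(ler_pM2r n0); apply: le_trans (dotv_le_norm HB _ _).
rewrite -normrN -dotvNl -eqs ger0_norm; last first.
  rewrite mulmxDl -scalemxAl dotvDl dotvZl addr_ge0 ?hessian_ge0 //.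
  by rewrite mulr_ge0 ?(ltW lam0) ?pform_ge0.
rewrite mulmxDl -scalemxAl dotvDl dotvZl -mulrA -expr2 sqr_pnorm //.
by rewrite lerDr hessian_ge0.
Qed.

(** The Newton equation turns the residual into the gradient increment minus [hessian f z *m s]. The
    Hessian difference left by the mean value theorem is at most [L * D], as [D] bounds the distance
    from [z] to the segment. *)
Lemma newton_residual_le x z s (lam D : R) :
  (hessian f z + lam *: B) *m s = - gradient f x ->
  (forall t : R, 0 <= t <= 1 -> pnorm B (x + t *: s - z) <= D) ->
  dnorm B (gradient f (x + s) + lam *: (B *m s)) <= L * D * pnorm B s.
Proof.
move=> eqs sD; set w := _ + _.
have [w0|w0] := eqVneq w 0.
  rewrite w0 (dnorm0 HB) !mulr_ge0 ?pnorm_ge0 ?(ltW L0) //.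
  by apply: le_trans (sD 0 _); rewrite ?pnorm_ge0 // lexx ler01.
have n0 := dnorm_gt0 HB w0.
have wE : w = gradient f (x + s) - gradient f x - hessian f z *m s.
  by rewrite -eqs mulmxDl -scalemxAl addrA [RHS]addrAC addrK.
case: fC2 => _ dg _.
(* Tested against [invmx B *m w], the residual [w] gives its own squared dual norm. *)
have [t t01 mvt] := gradient_mvt x s (invmx B *m w) dg.
rewrite -(ler_pM2r n0) -expr2 sqr_dnorm // {1}wE !(dotvDl, dotvNl) mvt.
rewrite -dotvNl -dotvDl -mulmxBl.
apply: le_trans (le_trans (ler_norm _) (dotv_le_norm HB _ _)) _.
rewrite -dnormE //; apply: ler_wpM2r; first exact: dnorm_ge0.
apply: le_trans (dnorm_mul_le HB _ _) _; apply: ler_wpM2r; first exact: pnorm_ge0.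
by apply: le_trans (fLip _ _) _; rewrite ler_pM2l // sD.
Qed.

(** Convexity at [x + s] bounds the decrease below by minus the product of the new gradient with
    [s]; expanding the squared residual bound controls this product. *)
Lemma newton_step_decrease x z s (lam D : R) : 0 < lam ->
  (hessian f z + lam *: B) *m s = - gradient f x ->
  (forall t : R, 0 <= t <= 1 -> pnorm B (x + t *: s - z) <= D) ->
  dnorm B (gradient f (x + s)) ^+ 2 / (2 * lam) + lam / 2 * pnorm B s ^+ 2
    - (L * D * pnorm B s) ^+ 2 / (2 * lam) <= f x - f (x + s).
Proof.
move=> lam0 eqs sD; have res := newton_residual_le eqs sD.
case: fC2 => df _ _; have := convex_gradient_le (- s) fconv (df (x + s)).
rewrite addrK dotvNr => /(le_trans _); apply.
set g := gradient f (x + s) in res *.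
have wE : dnorm B (g + lam *: (B *m s)) ^+ 2 =
    dnorm B g ^+ 2 + 2 * lam * dotv g s + lam ^+ 2 * pnorm B s ^+ 2.
  rewrite sqr_dnorm // mulmxDr -[invmx B *m (lam *: _)]scalemxAr mulKmx ?posdef_unitmx //.
  rewrite !(dotvDl, dotvDr, dotvZl, dotvZr) -sqr_dnorm // sqr_pnorm //.
  by rewrite [dotv _ (invmx B *m g)]pformC // mulKVmx ?posdef_unitmx //; ring.
have := lerXn2r 2 (dnorm_ge0 _ _) (le_trans (dnorm_ge0 _ _) res) res.
rewrite wE; set E := (_ * _ * _) ^+ 2 => H.
rewrite -(ler_pM2r (_ : 0 < 2 * lam)) ?mulr_gt0 // mulrBl mulrDl !divfK ?gt_eqF ?mulr_gt0 //.
lra.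
Qed.

End Step.

(** * Sums over blocks, and telescoping logarithms *)

Section Sums.
Variable R : realType.
Implicit Types (r g : nat -> R).

(** Power mean inequality, by induction: the first terms are replaced by their mean [u] and the new
    term [a] is added. *)
Lemma sum_cube_le r n : (forall i, 0 <= r i) ->
  (\sum_(i < n) r i) ^+ 3 <= n%:R ^+ 2 * \sum_(i < n) r i ^+ 3.
Proof.
move=> r0; elim: n => [|n IH]; first by rewrite !big_ord0 expr0n mulr0.
rewrite !big_ord_recr /=; set S := \sum_(i < n) r i in IH *.
set T := \sum_(i < n) _ in IH *; have a0 := r0 n; move: (r n) a0 => a a0.
case: n @S @T IH => [|n] S T IH.
  by rewrite /S /T !big_ord0 !add0r expr1n mul1r.
have S0 : 0 <= S by exact: sumr_ge0.
set q : R := n.+1%:R in IH *; have q0 : 0 < q by rewrite ltr0n.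
have -> : n.+2%:R = q + 1 :> R by rewrite -natr1.
pose u := S / q; have u0 : 0 <= u by rewrite divr_ge0 // ltW.
have SE : S = q * u by rewrite mulrC divfK // gt_eqF.
have TE : q * u ^+ 3 <= T.
  rewrite -(ler_pM2l (exprn_gt0 2 q0)); apply: le_trans IH; rewrite SE.
  by rewrite le_eqVlt; apply/orP; left; apply/eqP; ring.
(* This product is exactly [(q + 1) ^+ 2 * (q * u ^+ 3 + a ^+ 3) - (q * u + a) ^+ 3]. *)
have key : 0 <= q * (u - a) ^+ 2 * ((2 * q + 1) * u + (q + 2) * a).
  apply: mulr_ge0; first by rewrite mulr_ge0 ?sqr_ge0 // ltW.
  by apply: addr_ge0; apply: mulr_ge0 => //; lra.
apply: le_trans (_ : (q + 1) ^+ 2 * (q * u ^+ 3 + a ^+ 3) <= _).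
  rewrite SE -subr_ge0; apply: le_trans key _.
  by rewrite le_eqVlt; apply/orP; left; apply/eqP; ring.
by rewrite ler_pM2l ?exprn_gt0 ?addr_gt0 // lerD2r.
Qed.

(** Each partial sum is at most the full sum, so the left side is at most the cube of the full
    sum. *)
Lemma block_sum_le r n : (forall i, 0 <= r i) ->
  \sum_(k < n) r k * (\sum_(j < k.+1) r j) ^+ 2 <= n%:R ^+ 2 * \sum_(i < n) r i ^+ 3.
Proof.
move=> r0; apply: le_trans (sum_cube_le n r0).
rewrite [leRHS]exprS mulr_suml; apply: ler_sum => k _.
apply: ler_wpM2l => //; apply: lerXn2r; rewrite ?nnegrE ?sumr_ge0 //.
rewrite (big_ord_widen_cond n predT r (ltn_ord k)) [leRHS](bigID (fun j : 'I_n => j < k.+1)%N) /=.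
by rewrite lerDl sumr_ge0.
Qed.

(** Cut the indices into full blocks of length [m] and a remainder; on each block the snapshot stays
    at its first index. *)
Lemma snapshot_sum_le r m n : (0 < m)%N -> (forall i, 0 <= r i) ->
  \sum_(k < n) r k * (\sum_(snapshot m k <= j < k.+1) r j) ^+ 2 <=
  m%:R ^+ 2 * \sum_(k < n) r k ^+ 3.
Proof.
move=> m0 r0.
pose G k := r k * (\sum_(snapshot m k <= j < k.+1) r j) ^+ 2.
have snapE q i : (i < m)%N -> snapshot m (q * m + i) = (q * m)%N.
  by move=> im; rewrite /snapshot modnMDl modn_small // addnK.
have block q p : (p <= m)%N ->
    \sum_(i < p) G (q * m + i)%N <= m%:R ^+ 2 * \sum_(i < p) r (q * m + i)%N ^+ 3.
  (* A block may be incomplete, with length [p <= m]; the factor [p ^+ 2] is raised to [m ^+ 2]. *)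
  move=> pm; apply: le_trans (_ : p%:R ^+ 2 * \sum_(i < p) r (q * m + i)%N ^+ 3 <= _); last first.
    apply: ler_wpM2r; first by apply: sumr_ge0 => i _; exact: exprn_ge0.
    by apply: lerXn2r; rewrite ?nnegrE ?ler0n ?ler_nat.
  apply: le_trans (block_sum_le p (fun i => r0 (q * m + i)%N)).
  rewrite le_eqVlt; apply/orP; left; apply/eqP; apply: eq_bigr => i _.
  rewrite /G snapE ?(leq_trans (ltn_ord i)) //; congr (_ * _ ^+ 2).
  rewrite -{1}[(q * m)%N]add0n -addnS big_addn addKn big_mkord.
  by apply: eq_bigr => j _; rewrite addnC.
have full q : \sum_(k < q * m) G k <= m%:R ^+ 2 * \sum_(k < q * m) r k ^+ 3.
  elim: q => [|q IH]; first by rewrite !big_ord0 mulr0.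
  rewrite mulSnr !big_split_ord /= mulrDr; apply: lerD => //.
  exact: block.
rewrite (divn_eq n m) !big_split_ord /= mulrDr; apply: lerD; first exact: full.
by apply: block; rewrite ltnW // ltn_pmod.
Qed.

(** This is [ln (1 + y) <= y] at [y = Num.sqrt t - 1]. *)
Lemma ln_le_sqrt (t : R) : 0 < t -> 1 + ln t / 2 <= Num.sqrt t.
Proof.
move=> t0; have s0 : 0 < Num.sqrt t by rewrite sqrtr_gt0.
have <- : ln (Num.sqrt t) = ln t / 2.
  rewrite -{2}(sqr_sqrtr (ltW t0)) lnXn // -[X in X / 2]mulr_natr mulfK //.
have := @le_ln1Dx R (Num.sqrt t - 1).
by rewrite addrCA subrr addr0 => H; rewrite -lerBrDl H // ltrBDl subrr.
Qed.

Lemma sum_sqrt_ratio_ge g k : (forall i, (i <= k)%N -> 0 < g i) ->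
  k%:R + ln (g k / g 0%N) / 2 <= \sum_(i < k) Num.sqrt (g i.+1 / g i).
Proof.
elim: k => [|k IH] g0.
  by rewrite big_ord0 divff ?ln1 ?mul0r ?addr0 // gt_eqF // g0.
rewrite big_ord_recr /= -natr1.
have gk := g0 _ (leqnSn k); have gk1 := g0 _ (leqnn k.+1); have g00 := g0 0%N isT.
have /IH {}IH : forall i, (i <= k)%N -> 0 < g i by move=> i /leqW /g0.
have := ln_le_sqrt (divr_gt0 gk1 gk); move: IH; rewrite !ln_div ?posrE //; lra.
Qed.

(** Used with [w = m L] and consecutive gradient norms [b], [a]. Of the power 2 of [a], 3/2 is
    bounded below through [eps] and 1/2 is kept for the ratio; [Num.sqrt 3 <= 2] yields the constant
    4. *)
Lemma sqrt_ratio_le (w eps a b : R) : 0 < w -> 0 < eps -> 0 < b -> eps <= a ->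
  Num.sqrt eps ^+ 3 / (4 * Num.sqrt w) * Num.sqrt (a / b) <=
  a ^+ 2 / (2 * Num.sqrt (3 * w * b)).
Proof.
move=> w0 eps0 b0 ea; have a0 : 0 < a := lt_le_trans eps0 ea.
have s3 : Num.sqrt 3 <= 2 :> R.
  by rewrite -[leRHS](@ger0_norm R) // -sqrtr_sqr ler_sqrt ?sqr_ge0 //; lra.
have s30 : 0 < Num.sqrt 3 :> R by rewrite sqrtr_gt0.
rewrite !sqrtrM ?mulr_ge0 ?(ltW w0) ?(ltW a0) // sqrtrV ?(ltW b0) //.
have : Num.sqrt eps <= Num.sqrt a by exact: ler_wsqrtr.
rewrite (_ : a ^+ 2 = (Num.sqrt a ^+ 2) ^+ 2); last by rewrite sqr_sqrtr // ltW.
set e := Num.sqrt eps; set p := Num.sqrt a; set q := Num.sqrt b; set c := Num.sqrt w => ep.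
have e0 : 0 < e by rewrite sqrtr_gt0.
have p0 : 0 < p by rewrite sqrtr_gt0.
have q0 : 0 < q by rewrite sqrtr_gt0.
have c0 : 0 < c by rewrite sqrtr_gt0.
apply: le_trans (_ : (p ^+ 2) ^+ 2 / (4 * c * q) <= _).
  have -> : e ^+ 3 / (4 * c) * (p / q) = e ^+ 3 * p / (4 * c * q).
    by field; rewrite !gt_eqF.
  apply: ler_wpM2r; first by rewrite invr_ge0 ltW // !mulr_gt0.
  have -> : (p ^+ 2) ^+ 2 = p ^+ 3 * p by ring.
  by rewrite ler_pM2r // lerXn2r // nnegrE ltW.
apply: ler_wpM2l; first exact: sqr_ge0.
rewrite lef_pV2 ?posrE ?mulr_gt0 // !mulrA ler_pM2r // ler_pM2r //; lra.
Qed.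

End Sums.

(** * Counting the Hessian updates *)

Lemma mul_hessian_updates_le m k : (0 < m)%N -> (hessian_updates m 1 k * m <= k)%N.
Proof.
move=> m0; rewrite /hessian_updates -sum1_count big_mkcond /=.
suff -> : (\sum_(1 <= i < k.+1) (if (m %| i)%N then 1 else 0) = k %/ m)%N by exact: leq_trunc_div.
by rewrite divn_count_dvd; apply: eq_bigr => i _; case: (_ %| _)%N.
Qed.

Lemma hessian_updates0 m k : (hessian_updates m 0 k = (hessian_updates m 1 k).+1)%N.
Proof. by rewrite /hessian_updates /index_iota !subSS !subn0 /= dvdn0 add1n. Qed.

(** * Decrease along the lazy method and the iteration bound *)

Section LazyNewton.
Variables (R : realType) (d : nat) (B : 'M[R]_d) (f : 'cV[R]_d -> R) (L : R).
Variables (m : nat) (x : nat -> 'cV[R]_d).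
Hypotheses (HB : sym_posdef B) (fconv : convex_function [set: 'cV[R]_d] f).
Hypothesis fC2 : twice_continuously_differentiable f.
Hypothesis fLip :
  forall y z, opnorm B (hessian f y - hessian f z) <= L * pnorm B (y - z).
Hypotheses (L0 : 0 < L) (m0 : (0 < m)%N).
Hypothesis xN : lazy_newton B f m (3 * m%:R * L) x.

Let g k := dnorm B (gradient f (x k)).
Let r k := pnorm B (x k.+1 - x k).
Let lam k := Num.sqrt (3 * m%:R * L * g k).

(** Telescope from the snapshot; the fraction [t] of the current step is bounded by all of it, so
    the sum includes [j = k]. *)
Lemma snapshot_dist_le k (t : R) : 0 <= t <= 1 ->
  pnorm B (x k + t *: (x k.+1 - x k) - x (snapshot m k)) <=
  \sum_(snapshot m k <= j < k.+1) r j.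
Proof.
move=> /andP[t0 t1]; have ak : (snapshot m k <= k)%N by exact: leq_subr.
rewrite big_nat_recr //= addrAC -telescope_sumr //.
apply: le_trans (pnormD HB _ _) _; apply: lerD; first exact: pnorm_sum.
by rewrite pnormZ ger0_norm // ler_piMl // pnorm_ge0.
Qed.

(** Inserting [3 m L r_k <= lam_k] into the one-step decrease turns the quadratic gain into a cubic
    one and removes [lam_k] from the error. *)
Lemma lazy_step_decrease k : gradient f (x k) != 0 ->
  g k.+1 ^+ 2 / (2 * lam k) + (3 / 2 * m%:R * L * r k ^+ 3
   - L / (6 * m%:R) * (r k * (\sum_(snapshot m k <= j < k.+1) r j) ^+ 2))
  <= f (x k) - f (x k.+1).
Proof.
move=> gk0; have mR : 0 < m%:R :> R by rewrite ltr0n.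
set D := \sum_(_ <= j < _) _; have gk := dnorm_gt0 HB gk0.
have M0 : 0 < 3 * m%:R * L by rewrite !mulr_gt0.
have lam0 : 0 < lam k by rewrite sqrtr_gt0 mulr_gt0.
have lam2 : lam k ^+ 2 = 3 * m%:R * L * g k by rewrite sqr_sqrtr // ltW // mulr_gt0.
pose s := x k.+1 - x k; have xs : x k + s = x k.+1 by rewrite addrC subrK.
have eqs : (hessian f (x (snapshot m k)) + lam k *: B) *m s = - gradient f (x k).
  rewrite /s xN // addrAC subrr add0r mulmxN mulKVmx //.
  exact: regularized_hessian_unitmx.
have r0 : 0 <= r k by exact: pnorm_ge0.
have Mr : 3 * m%:R * L * r k <= lam k.
  rewrite -(ler_pM2l lam0) -expr2 lam2 mulrCA ler_pM2l //.
  exact: (newton_step_le HB fconv fC2 lam0 eqs).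
have := newton_step_decrease HB fconv fC2 fLip L0 lam0 eqs (@snapshot_dist_le k).
rewrite xs -/(g k.+1) -/(r k) -/D; apply: le_trans.
rewrite -addrA lerD2l; apply: lerB.
  have -> : 3 / 2 * m%:R * L * r k ^+ 3 = (3 * m%:R * L * r k) / 2 * r k ^+ 2 by ring.
  by apply: ler_wpM2r; [exact: sqr_ge0 | rewrite ler_pM2r].
(* Multiplying by [2 * lam k] avoids a division by [r k], which may be zero. *)
rewrite ler_pdivrMr ?mulr_gt0 //.
have -> : (L * D * r k) ^+ 2 =
    L / (6 * m%:R) * (r k * D ^+ 2) * (2 * (3 * m%:R * L * r k)).
  by field; rewrite gt_eqF.
apply: ler_wpM2l; last by rewrite ler_pM2l.
apply: mulr_ge0; last by rewrite mulr_ge0 ?sqr_ge0.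
by rewrite divr_ge0 ?mulr_ge0 // ltW.
Qed.

(** With [T] the sum of the cubes, the errors total at most [m L T / 6], below the cubic gain
    [3 m L T / 2]. *)
Lemma lazy_total_decrease n : (forall k, (k < n)%N -> gradient f (x k) != 0) ->
  \sum_(k < n) g k.+1 ^+ 2 / (2 * lam k) <= f (x 0%N) - f (x n).
Proof.
move=> gn0; have mR : 0 < m%:R :> R by rewrite ltr0n.
have -> : f (x 0%N) - f (x n) = \sum_(k < n) (f (x k) - f (x k.+1)).
  elim: n {gn0} => [|n IH]; first by rewrite big_ord0 subrr.
  by rewrite big_ord_recr /= -IH addrA subrK.
apply: le_trans (ler_sum _ (fun (k : 'I_n) _ => lazy_step_decrease (gn0 k (ltn_ord k)))).
rewrite big_split /= lerDl sumrB subr_ge0 -!mulr_sumr.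
have r0 i : 0 <= r i by exact: pnorm_ge0.
have := snapshot_sum_le n m0 r0; set T := \sum_(k < n) r k ^+ 3 => H.
have T0 : 0 <= T by apply: sumr_ge0 => i _; exact: exprn_ge0.
apply: le_trans (_ : L / (6 * m%:R) * (m%:R ^+ 2 * T) <= _).
  by apply: ler_wpM2l H; rewrite divr_ge0 ?mulr_ge0 // ltW.
have -> : L / (6 * m%:R) * (m%:R ^+ 2 * T) = 1 / 6 * (m%:R * L * T).
  by field; rewrite gt_eqF.
have : 0 <= m%:R * L * T by rewrite !mulr_ge0 // ltW.
lra.
Qed.

(** Bounding [2 * k] leaves slack for the update at index 0. The last hypothesis ensures
    [eps <= g k] even for [k = 0], so that [ln (g k)] can be replaced by [ln eps]. *)
Lemma lazy_iterations_le (fstar eps : R) k :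
  (forall y, fstar <= f y) -> 0 < eps -> gradient f (x 0%N) != 0 ->
  (forall i : nat, (1 <= i <= k)%N -> eps <= g i) ->
  (1 <= k)%N \/ eps <= g 0%N ->
  2 * k%:R <= 8 * (Num.sqrt (m%:R * L) * (f (x 0%N) - fstar) / eps `^ (3 / 2))
              + ln (g 0%N / eps).
Proof.
(* The closing linear arithmetic: [K] is the count, [S] the sum of root ratios, and [l0], [lk], [le]
   are the logarithms of [g 0], [g k] and [eps]. *)
have lin (K S Z l0 lk le : R) : le <= lk -> K + (lk - l0) / 2 <= S -> 2 * S <= Z ->
  2 * K <= Z + (l0 - le) by lra.
move=> fs eps0 g00 geps kg; have mR : 0 < m%:R :> R by rewrite ltr0n.
have gpos i : (i <= k)%N -> 0 < g i.
  case: i => [_|i ik]; first exact: dnorm_gt0.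
  by apply: lt_le_trans eps0 _; apply: geps.
have gn0 i : (i < k)%N -> gradient f (x i) != 0.
  move=> ik; apply: contraTneq (gpos _ (ltnW ik)) => gi.
  by rewrite /g gi dnorm0 // ltxx.
have gk : eps <= g k.
  have [k0|k1] := posnP k; last by apply: geps; rewrite k1 leqnn.
  by case: kg; rewrite k0.
pose e := Num.sqrt eps; have e0 : 0 < e by rewrite sqrtr_gt0.
have e2 : eps = e ^+ 2 by rewrite sqr_sqrtr // ltW.
have e3 : eps `^ (3 / 2) = e ^+ 3.
  rewrite (_ : 3 / 2 = 1 + 2^-1 :> R); last by field.
  by rewrite powRD ?powRr1 ?powR12_sqrt ?ltW // -/e ?e2 ?exprSr // gt_eqF // implybT.
pose c := Num.sqrt (m%:R * L); have c0 : 0 < c by rewrite sqrtr_gt0 mulr_gt0.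
pose S := \sum_(i < k) Num.sqrt (g i.+1 / g i).
have S0 : 0 <= S by apply: sumr_ge0 => i _; exact: sqrtr_ge0.
have SF : e ^+ 3 / (4 * c) * S <= f (x 0%N) - fstar.
  apply: le_trans (_ : f (x 0%N) - f (x k) <= _); last by rewrite lerD2l lerN2.
  apply: le_trans (lazy_total_decrease gn0); rewrite mulr_sumr.
  apply: ler_sum => i _.
  rewrite /lam -[3 * m%:R * L]mulrA; apply: sqrt_ratio_le.
  - exact: mulr_gt0.
  - exact: eps0.
  - by apply: gpos; exact: ltnW.
  - by apply: geps; rewrite /= ltn_ord.
(* The 8 is twice the 4 of [sqrt_ratio_le]. *)
have S8 : 2 * S <= 8 * (c * (f (x 0%N) - fstar) / eps `^ (3 / 2)).
  rewrite e3; move: (f _ - _) (e ^+ 3) (exprn_gt0 3 e0) SF => F E E0 SF.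
  have -> : 2 * S = 8 * c / E * (E / (4 * c) * S) by field; rewrite !gt_eqF.
  have -> : 8 * (c * F / E) = 8 * c / E * F by field; rewrite gt_eqF.
  by rewrite ler_pM2l // divr_gt0 ?mulr_gt0.
rewrite (ln_div (gpos _ (leq0n k)) (eps0 : eps \is Num.pos)).
apply: lin S8; last first.
  have := sum_sqrt_ratio_ge gpos.
  by rewrite (ln_div (gpos _ (leqnn k)) (gpos _ (leq0n k))); apply.
by rewrite (ler_ln (eps0 : eps \is Num.pos) (gpos _ (leqnn k))).
Qed.

End LazyNewton.

(** * Reaching the accuracy, and both complexity bounds *)

Theorem theorem4p1 (R : realType) :
  exists C1 C2 : R, 0 < C1 /\ 0 < C2 /\
  forall (d : nat) (B : 'M[R]_d) (f : 'cV[R]_d -> R) (fstar L : R)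
         (m : nat) (eps : R) (x : nat -> 'cV[R]_d),
  sym_posdef B ->
  convex_function [set: 'cV[R]_d] f ->
  twice_continuously_differentiable f ->
  (forall y, fstar <= f y) ->
  0 < L ->
  (forall y z, opnorm B (hessian f y - hessian f z) <= L * pnorm B (y - z)) ->
  (1 <= m)%N ->
  0 < eps ->
  gradient f (x 0%N) != 0 ->
  lazy_newton B f m (3 * m%:R * L) x ->
  (exists k : nat,
     (forall i : nat, (1 <= i <= k)%N -> eps <= dnorm B (gradient f (x i))) /\
     dnorm B (gradient f (x k.+1)) <= eps) /\
  (forall k : nat,
     (forall i : nat, (1 <= i <= k)%N -> eps <= dnorm B (gradient f (x i))) ->
     (1 <= k)%N \/ eps <= dnorm B (gradient f (x 0%N)) ->
     let kbound := C1 * (Num.sqrt (m%:R * L) * (f (x 0%N) - fstar)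
                         / eps `^ (3 / 2))
                   + C2 * ln (dnorm B (gradient f (x 0%N)) / eps) in
     let tbound := C1 * (Num.sqrt L * (f (x 0%N) - fstar)
                         / (eps `^ (3 / 2) * Num.sqrt m%:R))
                   + C2 / m%:R * ln (dnorm B (gradient f (x 0%N)) / eps) in
     k%:R <= kbound /\
     (hessian_updates m 1 k)%:R <= tbound /\
     ((m <= k)%N -> (hessian_updates m 0 k)%:R <= tbound)).
Proof.
exists 8, 1; split=> //; split=> //.
move=> d B f fstar L m eps x HB fconv fC2 fs L0 fLip m0 eps0 g00 xN.
have bound k := lazy_iterations_le HB fconv fC2 fLip L0 m0 xN (k := k) fs eps0 g00.
split.
  have [ex|nex] := pselect (exists k, dnorm B (gradient f (x k.+1)) <= eps).
    (* By minimality of [k], the gradients at indices 1 to [k] are still large. *)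
    case: (ex_minnP ex) => k gk kmin; exists k; split => // -[//|i] /= ik.
    by rewrite leNgt; apply/negP => /ltW /kmin; rewrite leqNgt ik.
  (* Otherwise the bound [K], free of [k], holds at every index, and [2 (N + 1) <= K < N + 1] is
     absurd. *)
  have big k : eps <= dnorm B (gradient f (x k.+1)).
    by rewrite leNgt; apply/negP => /ltW H; apply: nex; exists k.
  set K := 8 * _ + _ in bound.
  have [N KN] : exists N : nat, K < N.+1%:R.
    exists (Num.truncn K); exact: truncnS_gt.
  have NK : 2 * N.+1%:R <= K.
    by apply: bound; [case=> [|i] // _; exact: big | left].
  have N0 : 0 <= N.+1%:R :> R by [].
  lra.
move=> k geps kg kbound tbound.
have mR : 0 < m%:R :> R by rewrite ltr0n.
have k2 : 2 * k%:R <= kbound by rewrite /kbound mul1r; exact: bound.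
have k0 : 0 <= k%:R :> R by [].
(* Both update bounds are compared with [kbound] after multiplication by [m]. *)
have tE : tbound * m%:R = kbound.
  rewrite /tbound /kbound sqrtrM ?ler0n //.
  set q := Num.sqrt m%:R; have q0 : 0 < q by rewrite sqrtr_gt0.
  have -> : m%:R = q ^+ 2 :> R by rewrite sqr_sqrtr // ltW.
  by field; rewrite !gt_eqF // powR_gt0.
split; first by lra.
have tk : (hessian_updates m 1 k)%:R * m%:R <= k%:R :> R.
  by rewrite -natrM ler_nat mul_hessian_updates_le.
split; first by rewrite -(ler_pM2r mR) tE; lra.
(* With [t] updates after index 0, [(t + 1) m <= k + m <= 2 k <= kbound]. *)
move=> mk; rewrite hessian_updates0 -(ler_pM2r mR) tE -natr1 mulrDl mul1r.
have : m%:R <= k%:R :> R by rewrite ler_nat.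
lra.
Qed.
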